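(* Let $n$ be an odd prime number, let $\mathbb{F}_q$ be a finite field of characteristic $p$ with $n\neq p$, and let $f$ be a nontrivial multiplicative function with values in $\mathbb{F}_q$, extended by $f(0)=f(n)=0$. Let $A:\mathbb{F}_q^n\to\mathbb{F}_q^n$ be a translation-invariant operator representable in the form $A=B\Delta$ with $B$ a translation-invariant operator, and let $\mathcal{B}(y)=\sum_{i=1}^{n} b_i y^{i-1}\in\mathbb{F}_q[y]$, where $(b_1,\dots,b_n)^T$ is the first column of the matrix of $B$. Then $f$ is a most complicated function of $A$ if and only if $$\gcd\Bigl(\mathcal{B}(y),\ \sum_{i=0}^{n-1} y^i\Bigr)\ne 1 \quad\text{in } \mathbb{F}_q[y].$$
   Context: Vectors of $\mathbb{F}_q^n$ are columns $x=(x_1,\dots,x_n)^T$, and matrices of operators are taken in the standard basis. The cyclic shift operator $\delta$ on $\mathbb{F}_q^n$ is $\delta(x_1,x_2,\dots,x_n)^T=(x_2,\dots,x_n,x_1)^T$. A linear operator $A:\mathbb{F}_q^n\to\mathbb{F}_q^n$ is called translation-invariant if $A\delta=\delta A$. The finite differentiation operator is $\Delta=\delta-I$, where $I$ is the identity operator. The gcd of polynomials is normalized to be monic, so that ''$\ne 1$'' means the polynomials are not coprime. For $n$ prime, a function $f:\{1,\dots,n-1\}\to\mathbb{F}_q$ is called multiplicative if $f(ij \bmod n)=f(i)f(j)$ for all $i,j\in\{1,\dots,n-1\}$ and $f$ is not identically zero. It is nontrivial if it is not identically equal to $1$. For a linear operator $A$ on $\mathbb{F}_q^n$ and $x\in\mathbb{F}_q^n$,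 the sequence $x,Ax,A^2x,\dots$ is eventually periodic; its preperiod is the least $m\ge 0$ such that $A^m x=A^{m+t}x$ for some $t\ge 1$, and its period is the length of the cycle it eventually enters. A function $f$ with values in $\mathbb{F}_q$ is identified with the vector $x=(f(1),\dots,f(n))^T$. The function $f$ is called a most complicated function of $A$ if the sequence $x,Ax,A^2x,\dots$ has both the maximal period and the maximal preperiod, the maxima being taken over all starting vectors in $\mathbb{F}_q^n$ (for the given $A$). *)

(* Defs.v *)
From HB Require Import structures.
From mathcomp Require Import all_boot all_order all_algebra.

Set Implicit Arguments.
Unset Strict Implicit.
Unset Printing Implicit Defensive.

Import GRing.Theory.
Local Open Scope ring_scope.

Section Dynamics.
Variables (T : finType) (g : T -> T).

(* The bound #|T| on the return time only serves to make the condition        *)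
(* boolean: by recursP, the existence of an arbitrary t >= 1 is equivalent.   *)
Definition recurs (x : T) (m : nat) : bool :=
  [exists t : 'I_#|T|, iter m g x == iter (m + t.+1) g x].

Lemma recursP x m :
  reflect (exists t, (1 <= t)%N /\ iter m g x = iter (m + t) g x) (recurs x m).
Proof.
apply: (iffP existsP) => [[t /eqP gmt]|[[|t] [//= _]]]; first by exists t.+1.
set y := iter m g x; rewrite addnC iterD -/y iterSr => y_t.
have gy_y : fconnect g (g y) y by rewrite {2}y_t fconnect_iter.
have lt_t : (findex g (g y) y < #|T|)%N.
  exact: leq_trans (findex_max gy_y) (max_card _).
by exists (Ordinal lt_t); rewrite addnC iterD -/y iterSr /= iter_findex.
Qed.

Lemma ex_recurs x : exists m, recurs x m.
Proof.
have /trajectP[m lt_m eq_m] := looping_order g x.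
exists m; apply/recursP; exists (order g x - m)%N.
by rewrite subn_gt0 lt_m subnKC ?(ltnW lt_m).
Qed.

Definition preperiod (x : T) : nat := ex_minn (ex_recurs x).

(* [order g y] is the number of distinct iterates of y, which is the length   *)
(* of the cycle of y as soon as y lies on a cycle.                            *)
Definition period (x : T) : nat := order g (iter (preperiod x) g x).

Lemma periodP x (m := preperiod x) :
  [/\ (1 <= period x)%N, iter m g x = iter (m + period x) g x
    & forall t, (1 <= t)%N -> iter m g x = iter (m + t) g x ->
      (period x <= t)%N].
Proof.
rewrite /period -/m; set y := iter m g x.
have cycle_y t : y = iter (m + t.+1) g x -> fcycle g (traject g y t.+1).
  rewrite addnC iterD -/y => y_t.
  by rewrite /= rcons_path fpath_traject /= last_traject -iterS -y_t /=.
have /recursP[[|t] [// _ y_t]] : recurs x m.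
  by rewrite /m /preperiod; case: ex_minnP.
have cyc := cycle_y _ y_t.
split=> [||[//|s] _ y_s].
- by rewrite /order; apply/card_gt0P; exists y; apply: connect0.
- by rewrite addnC iterD -/y (iter_order_cycle cyc) // mem_head.
- rewrite -[leqRHS](size_traject g y) order_le_cycle ?mem_head //.
  exact: cycle_y y_s.
Qed.

Definition most_complicated (x : T) : Prop :=
  (forall y, period y <= period x)%N /\ (forall y, preperiod y <= preperiod x)%N.

End Dynamics.

Section Shift.
Variables (R : pzRingType) (n : nat).

Definition shift (x : 'cV[R]_n) : 'cV[R]_n := \col_(i < n) x (ordS i) 0.

Definition fdiff (x : 'cV[R]_n) : 'cV[R]_n := shift x - x.

Lemma shift_is_linear : linear shift.
Proof. by move=> a x y; apply/colP => i; rewrite !mxE. Qed.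

HB.instance Definition _ :=
  GRing.isLinear.Build R 'cV[R]_n 'cV[R]_n _ shift shift_is_linear.

Lemma fdiff_is_linear : linear fdiff.
Proof. by move=> a x y; rewrite /fdiff linearP scalerBr opprD addrACA. Qed.

HB.instance Definition _ :=
  GRing.isLinear.Build R 'cV[R]_n 'cV[R]_n _ fdiff fdiff_is_linear.

Definition translation_invariant (A : 'cV[R]_n -> 'cV[R]_n) : Prop :=
  A \o shift =1 shift \o A.

(* Matrix in the standard basis: column j is the image of the j-th basis      *)
(* vector.                                                                    *)
Definition opmx (A : 'cV[R]_n -> 'cV[R]_n) : 'M[R]_n :=
  \matrix_(i, j) A (delta_mx j 0) i 0.

End Shift.

(* Indices start at 0, so the i-th entry of the first column is the           *)
(* coefficient of degree i.                                                   *)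
Definition column_poly (R : nzRingType) (n : nat) (n_gt0 : (0 < n)%N)
    (B : 'cV[R]_n -> 'cV[R]_n) : {poly R} :=
  \sum_(i < n) opmx B i (Ordinal n_gt0) *: 'X^i.

(* The functions on {1, ..., n-1} and their extensions to {0, ..., n} are     *)
(* represented by functions on nat, whose values elsewhere are irrelevant.    *)
Definition multiplicative_mod (R : nzRingType) (n : nat) (f : nat -> R) : Prop :=
  (forall i j, (1 <= i < n)%N -> (1 <= j < n)%N ->
     f ((i * j) %% n)%N = f i * f j)
  /\ exists2 i, (1 <= i < n)%N & f i <> 0.

Definition nontrivial_mod (R : nzRingType) (n : nat) (f : nat -> R) : Prop :=
  exists2 i, (1 <= i < n)%N & f i <> 1.

(* (f(1), ..., f(n))^T *)
Definition fun_vec (R : nzRingType) (n : nat) (f : nat -> R) : 'cV[R]_n :=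
  \col_(i < n) f i.+1.

(* Main.v *)
From HB Require Import structures.
Require Import Defs.
From mathcomp Require Import all_boot all_order all_algebra separable cyclotomic.
From mathcomp Require Import ring.
Set Implicit Arguments.
Unset Strict Implicit.
Unset Printing Implicit Defensive.
Import GRing.Theory.
Local Open Scope ring_scope.

(** Reading a vector [x] as the polynomial [col_poly x] turns the inverse of
    the shift into multiplication by ['X] modulo ['X^n - 1], so that [A] and
    [B] become multiplication by polynomials [a] and [b] (their first columns)
    and the relation [A = B \o fdiff] becomes
    ['X * a = b * (1 - 'X)] modulo ['X^n - 1] ([column_poly_fdiff]).  Write
    ['X^n - 1 = ('X - 1) * Phi].  Then ['X - 1] divides [a], and [a] is coprime
    to [Phi] exactly when [b] is ([coprime_column_poly]).

    Since [n] is invertible in the field, ['X^n - 1] is squarefree.  Hence [a]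
    and its powers have the same annihilators, and every preperiod is at most 1
    ([preperiod_le1]).  The value 1 is attained because [a] is not invertible
    ([preperiod_delta]).

    For the vector of [f] two facts matter.  Its entries sum to 0, so ['X - 1]
    divides its polynomial; and its polynomial is coprime to [Phi]
    ([coprime_fun_vec]).  The latter is the nonvanishing of Gauss sums, obtained
    without any extension field from the identity [G * G' = n * f (n - 1)]
    modulo [Phi] ([gauss_sum_mul]), where [G] and [G'] are the sums of
    [f i * 'X^i] and of [f i ^-1 * 'X^i] over the nonzero residues [i].  Thus [f] generates, as a module over the
    operators commuting with the shift, the space of vectors of sum 0.  This
    space contains the image of [A], so the period of [f] is maximal whatever
    [B] is ([period_max]), and the preperiod of [f] is 0 exactly when [A] is
    injective on that space, that is when [a] is coprime to [Phi]
    ([recurs0_coprime]). *)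

(** * Periods and preperiods *)

Section Dynamics.
Variables (T : finType) (g : T -> T).

Lemma preperiod_le x m : recurs g x m -> (preperiod g x <= m)%N.
Proof. by rewrite /preperiod; case: ex_minnP => k _; apply. Qed.

Lemma recurs_preperiod x : recurs g x (preperiod g x).
Proof. by rewrite /preperiod; case: ex_minnP. Qed.

Lemma preperiod_gt0 x : (0 < preperiod g x)%N = ~~ recurs g x 0.
Proof.
apply/idP/idP => [|nrec].
  by apply: contraTN => /preperiod_le; case: preperiod.
by rewrite lt0n; apply: contraNneq nrec => <-; apply: recurs_preperiod.
Qed.

(** The return time may be observed long after the entry into the cycle: going
    round the cycle [m] times from its entry point reaches a time at which the
    relation applies. *)
Lemma period_le x m t :
  (0 < t)%N -> iter m g x = iter (m + t) g x -> (period g x <= t)%N.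
Proof.
move=> t_gt0 eq_mt; have [p_gt0 eq_p p_min] := periodP g x.
apply: p_min => //; set r := preperiod g x in eq_p *.
have eq_late k : (m <= k)%N -> iter k g x = iter (k + t) g x.
  by move=> /subnK <-; rewrite -addnA !(iterD (k - m)) -eq_mt.
have eq_rp k : iter r g x = iter (r + k * period g x) g x.
  elim: k => [|k IHk]; first by rewrite mul0n addn0.
  by rewrite mulSn addnCA iterD -IHk -iterD addnC.
rewrite (addnC r t) iterD (eq_rp m) -iterD (addnC t) -eq_late //.
by rewrite (leq_trans (leq_pmulr m p_gt0)) // leq_addl.
Qed.

End Dynamics.

(** * Squarefree divisors *)

Section PolyDiv.
Variable F : fieldType.

(** The cofactor of [gcdp q c] in [q] is coprime to that gcd, hence to [c] and
    to its powers; it divides such a power, so it is a unit. *)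
Lemma separable_dvdp_exp (q c : {poly F}) m :
  separable_poly q -> q %| c ^+ m -> q %| c.
Proof.
move=> sep_q q_cm; set g := gcdp q c; set h := q %/ g.
have q_hg : h * g = q by rewrite divpK ?dvdp_gcdl.
have co_hg : coprimep h g.
  by have /separable_polyP[co_q _] := sep_q; apply: co_q; rewrite q_hg.
have h_q : h %| q by rewrite -q_hg dvdp_mulr.
have co_hc : coprimep h c.
  apply/coprimepP=> d d_h d_c; have /coprimepP := co_hg; apply=> //.
  by rewrite dvdp_gcd d_c (dvdp_trans d_h).
have h1 : h %| 1.
  rewrite -(Gauss_dvdpr _ (coprimep_expr m co_hc)) mulr1.
  exact: dvdp_trans h_q q_cm.
rewrite -q_hg; apply: dvdp_trans (dvdp_gcdr q c).
by rewrite -[X in _ %| X]mul1r dvdp_mul.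
Qed.

End PolyDiv.

(** * Gauss sums *)

Section GaussSum.
Variables (K : finFieldType) (S : comNzRingType) (chi psi : K -> S).
Hypotheses (chiM : {morph chi : x y / x * y}) (chi0 : chi 0 = 0).
Hypothesis (sum_chi : \sum_a chi a = 0).
Hypotheses (psiD : {morph psi : x y / x + y >-> x * y}) (psi0 : psi 0 = 1).
Hypothesis (sum_psi : \sum_a psi a = 0).

(** The classical computation: the substitution [a = c * b] in the double sum
    leaves [\sum_c chi c * \sum_(b | b != 0) psi ((c + 1) * b)], and the inner
    sum is [-1] except for [c = -1].  The values lie in an arbitrary commutative
    ring, so that the sums can be taken modulo a polynomial. *)
Lemma gauss_sum_mul :
  (\sum_a chi a * psi a) * (\sum_a chi a^-1 * psi a) = chi (-1) *+ #|K|.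
Proof.
have sum_psiM m :
    \sum_(b | b != 0) psi (m * b) = (if m == 0 then #|K|%:R else 0) - 1.
  apply/eqP; rewrite eq_sym subr_eq; apply/eqP.
  transitivity (\sum_b psi (m * b)); last first.
    by rewrite (bigD1 0) //= mulr0 psi0 addrC.
  case: eqP => [->|/eqP m_neq0].
    by under eq_bigr do rewrite mul0r psi0; rewrite sumr_const.
  by rewrite -[LHS]sum_psi (reindex_inj (mulfI m_neq0)).
transitivity (\sum_(b | b != 0) \sum_c chi c * psi ((c + 1) * b)).
  rewrite mulr_sumr (bigD1 0) //= invr0 chi0 mul0r mulr0 add0r.
  apply: eq_bigr => b b_neq0; rewrite mulr_suml (reindex_inj (mulIf b_neq0)) /=.
  apply: eq_bigr => c _; rewrite mulrDl mul1r psiD mulrACA -chiM.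
  by rewrite mulfK // !mulrA.
rewrite exchange_big /=; under eq_bigr do rewrite -mulr_sumr sum_psiM mulrBr mulr1.
rewrite sumrB sum_chi subr0 (bigD1 (-1)) //= addNr eqxx mulr_natr big1 ?addr0 //.
by move=> c; rewrite -subr_eq0 opprK => /negPf ->; rewrite mulr0.
Qed.

End GaussSum.

(** * Operators commuting with the shift as multiplications *)

Section CyclicModule.
Variables (F : fieldType) (n : nat) (n_gt0 : (0 < n)%N).
Implicit Types x y : 'cV[F]_n.

Notation N := ('X^n - 1 : {poly F}).
Notation Phi := (\sum_(i < n) 'X^i : {poly F}).
Let e0 : 'cV[F]_n := delta_mx (Ordinal n_gt0) 0.

Definition col_poly x : {poly F} := rVpoly x^T.

Lemma col_polyE x : col_poly x = \sum_(i < n) x i 0 *: 'X^i.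
Proof.
rewrite /col_poly [x^T]row_sum_delta linear_sum /=.
by apply: eq_bigr => i _; rewrite linearZ /= rVpoly_delta mxE.
Qed.

Fact col_poly_is_linear : linear col_poly.
Proof. by move=> c x y; rewrite /col_poly !linearP. Qed.

HB.instance Definition _ :=
  GRing.isLinear.Build F 'cV[F]_n {poly F} _ col_poly col_poly_is_linear.

Lemma col_poly_delta (i : 'I_n) : col_poly (delta_mx i 0) = 'X^i.
Proof. by rewrite /col_poly trmx_delta rVpoly_delta. Qed.

Lemma column_polyE (B : 'cV[F]_n -> 'cV[F]_n) :
  column_poly n_gt0 B = col_poly (B e0).
Proof. by rewrite col_polyE; apply: eq_bigr => i _; rewrite mxE. Qed.

Lemma col_poly_eq x y : (x == y) = (N %| col_poly x - col_poly y).
Proof.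
apply/eqP/idP=> [->|]; first by rewrite subrr dvdp0.
rewrite -linearB => /eqP; rewrite modp_small; last first.
  by rewrite size_XnsubC // ltnS size_poly.
move=> /(congr1 (@poly_rV F n)); rewrite rVpolyK linear0 => /(congr1 trmx).
by rewrite trmxK trmx0 => /eqP; rewrite subr_eq0 => /eqP.
Qed.

Lemma dvdp_Xn_mod k : N %| 'X^k - 'X^(k %% n).
Proof.
rewrite {1}(divn_eq k n) exprD mulnC exprM -[X in _ %| _ - X]mul1r -mulrBl.
by rewrite (subrX1 'X^n) -mulrA dvdp_mulr.
Qed.

(** The shift lowers indices, so it is multiplication by the inverse of ['X]. *)
Lemma col_poly_shift x : N %| 'X * col_poly (shift x) - col_poly x.
Proof.
rewrite !col_polyE mulr_sumr [X in _ %| _ - X](reindex_inj (@ordS_inj n)) -sumrB.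
apply: (big_ind (fun p => N %| p)) => [||i _]; first exact: dvdp0.
  exact: dvdp_add.
by rewrite mxE -scalerAr -exprS -scalerBr -mul_polyC dvdp_mull ?dvdp_Xn_mod.
Qed.

Lemma shift_delta k (lt_k1 : (k.+1 < n)%N) :
  shift (delta_mx (Ordinal lt_k1) 0)
    = delta_mx (Ordinal (ltnW lt_k1)) 0 :> 'cV[F]_n.
Proof.
apply/colP=> i; rewrite !mxE !andbT -!val_eqE /=; congr ((_ : bool)%:R).
have := ltn_ord i; rewrite leq_eqVlt => /predU1P[eq_i | lt_i].
  by rewrite eq_i modnn -[RHS]eqSS eq_i (gtn_eqF lt_k1).
by rewrite modn_small.
Qed.

Section Invariant.
Variables (B : {linear 'cV[F]_n -> 'cV[F]_n}) (B_inv : translation_invariant B).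

(** The basis vectors are the shift orbit of the first one, so the image of the
    first one, whose polynomial is the first column, determines [B]. *)
Lemma col_poly_linear x :
  N %| col_poly (B x) - column_poly n_gt0 B * col_poly x.
Proof.
have delta k (lt_k : (k < n)%N) :
    N %| col_poly (B (delta_mx (Ordinal lt_k) 0)) - column_poly n_gt0 B * 'X^k.
  elim: k lt_k => [|k IHk] lt_k.
    by rewrite column_polyE mulr1 (bool_irrelevance lt_k n_gt0) subrr dvdp0.
  have := dvdp_sub (dvdp_mull 'X (IHk (ltnW lt_k)))
                   (col_poly_shift (B (delta_mx (Ordinal lt_k) 0))).
  by rewrite -[shift _]B_inv /= shift_delta exprS; congr (_ %| _); ring.
rewrite {1}[x]matrix_sum_delta linear_sum /= (col_polyE x) mulr_sumr.
rewrite linear_sum -sumrB.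
apply: (big_ind (fun p => N %| p)) => [||i _]; first exact: dvdp0.
  exact: dvdp_add.
rewrite big_ord1 !linearZ /= -scalerAr -scalerBr -mul_polyC dvdp_mull //.
by case: i => i lt_i; apply: delta.
Qed.

Lemma col_poly_iter m x :
  N %| col_poly (iter m B x) - column_poly n_gt0 B ^+ m * col_poly x.
Proof.
elim: m => [|m IHm]; first by rewrite expr0 mul1r subrr dvdp0.
have := dvdp_add (col_poly_linear (iter m B x))
                 (dvdp_mull (column_poly n_gt0 B) IHm).
by rewrite exprS /=; congr (_ %| _); ring.
Qed.

Lemma iter_linear_eq m t x :
  (iter m B x == iter (m + t) B x) =
  (N %| column_poly n_gt0 B ^+ m * (1 - column_poly n_gt0 B ^+ t) * col_poly x).
Proof.
rewrite col_poly_eq.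
rewrite -(dvdp_subr _ (dvdp_sub (col_poly_iter m x) (col_poly_iter (m + t) x))).
by rewrite -dvdpNr exprD; congr (_ %| _); ring.
Qed.

End Invariant.

(** Obtained by evaluating [B \o fdiff] at the first basis vector, whose
    polynomial is 1. *)
Lemma column_poly_fdiff (A B : {linear 'cV[F]_n -> 'cV[F]_n}) :
  translation_invariant B -> A =1 B \o @fdiff F n ->
  N %| 'X * column_poly n_gt0 A - column_poly n_gt0 B * (1 - 'X).
Proof.
move=> B_inv A_B; rewrite (column_polyE A) A_B /=.
have := dvdp_add (dvdp_mull 'X (col_poly_linear B_inv (fdiff e0)))
                 (dvdp_mull (column_poly n_gt0 B) (col_poly_shift e0)).
have -> : col_poly (fdiff e0) = col_poly (shift e0) - 1.
  by rewrite /fdiff linearB /= col_poly_delta expr0.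
by rewrite [col_poly e0]col_poly_delta expr0; congr (_ %| _); ring.
Qed.

Lemma Xn_sub1_factor : N = ('X - 1%:P) * Phi.
Proof. by rewrite polyC1 -subrX1. Qed.

Lemma Phi_dvd : Phi %| N.
Proof. by rewrite Xn_sub1_factor dvdp_mull. Qed.

Lemma XsubC1_dvd : 'X - 1%:P %| N.
Proof. by rewrite Xn_sub1_factor dvdp_mulr. Qed.

Lemma Phi_horner1 : Phi.[1] = n%:R.
Proof.
rewrite horner_sum; under eq_bigr do rewrite hornerXn expr1n.
by rewrite sumr_const card_ord.
Qed.

Lemma PhiE : Phi = \poly_(i < n) 1.
Proof. by rewrite poly_def; under [RHS]eq_bigr do rewrite scale1r. Qed.

Lemma size_Phi : size Phi = n.
Proof. by rewrite PhiE size_poly_eq ?oner_eq0. Qed.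

Lemma Phi_monic : Phi \is monic.
Proof. by rewrite PhiE monicE lead_coef_poly ?oner_eq0. Qed.

Section Factorization.
Variables (A B : {linear 'cV[F]_n -> 'cV[F]_n}).
Hypotheses (B_inv : translation_invariant B) (A_B : A =1 B \o @fdiff F n).
Let a := column_poly n_gt0 A.
Let b := column_poly n_gt0 B.

Lemma dvdp_column_poly : 'X - 1%:P %| a.
Proof.
have := dvdp_trans XsubC1_dvd (column_poly_fdiff B_inv A_B); rewrite -/a -/b.
by rewrite !dvdp_XsubCl /root !hornerE subrr mulr0 subr0.
Qed.

(** ['X] and [1 - 'X] are both coprime to [Phi]: the value of [Phi] at 1 is
    [n]. *)
Lemma coprime_column_poly : n%:R != 0 :> F -> coprimep a Phi = coprimep b Phi.
Proof.
move=> n_neq0; have Xa := dvdp_trans Phi_dvd (column_poly_fdiff B_inv A_B).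
have /dvdpP[u def_u] := Xa; rewrite -/a -/b in def_u.
have co_X1 : coprimep Phi (1 - 'X).
  rewrite -opprB -scaleN1r coprimepZr ?oppr_eq0 ?oner_eq0 // -polyC1.
  by rewrite coprimep_XsubC /root Phi_horner1.
have co_X : coprimep Phi 'X.
  apply: (coprimep_dvdr Phi_dvd); rewrite coprimepX /root !hornerE.
  by rewrite expr0n (gtn_eqF n_gt0) sub0r oppr_eq0 oner_eq0.
rewrite !(coprimep_sym _ Phi).
transitivity (coprimep Phi ('X * a)); first by rewrite coprimepMr co_X.
transitivity (coprimep Phi (b * (1 - 'X))); last first.
  by rewrite coprimepMr co_X1 andbT.
by rewrite -(subrK (b * (1 - 'X)) ('X * a)) def_u coprimep_addl_mul.
Qed.

End Factorization.
End CyclicModule.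

(** * Maximal periods and preperiods *)

Section Complexity.
Variables (F : finFieldType) (n : nat) (n_gt0 : (0 < n)%N).
Hypothesis n_neq0 : n%:R != 0 :> F.
Variables (A : {linear 'cV[F]_n -> 'cV[F]_n}) (A_inv : translation_invariant A).
Implicit Types x y : 'cV[F]_n.

Notation N := ('X^n - 1 : {poly F}).
Notation Phi := (\sum_(i < n) 'X^i : {poly F}).
Let a := column_poly n_gt0 A.

Lemma recursE x m :
  recurs A x m <->
  exists2 t, (0 < t)%N & N %| a ^+ m * (1 - a ^+ t) * col_poly x.
Proof.
split=> [/recursP[t [t_gt0 /eqP]]|[t t_gt0 dv]].
  by rewrite (iter_linear_eq n_gt0) //; exists t.
by apply/recursP; exists t; split=> //; apply/eqP; rewrite (iter_linear_eq n_gt0).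
Qed.

(** If [a ^+ m] kills [(1 - a ^+ t) * col_poly x] modulo the squarefree
    polynomial ['X^n - 1], so does [a]. *)
Lemma preperiod_le1 x : (preperiod A x <= 1)%N.
Proof.
apply: preperiod_le; apply/recursE.
have /recursE[t t_gt0 dv] := recurs_preperiod A x.
exists t => //; move: (preperiod A x) dv => m dv.
(* The exponent [m.+1] rather than [m] covers the case [m = 0]. *)
apply: (@separable_dvdp_exp _ _ _ m.+1); first exact: separable_Xn_sub_1.
have -> : (a ^+ 1 * (1 - a ^+ t) * col_poly x) ^+ m.+1
  = a ^+ m * (1 - a ^+ t) * col_poly x * (a * ((1 - a ^+ t) * col_poly x) ^+ m).
  by rewrite expr1; move: (1 - _) => u; rewrite !exprMn !(exprS _ m); ring.
by rewrite dvdp_mulr.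
Qed.

Hypothesis a_X1 : 'X - 1%:P %| a.

(** The polynomial of this vector is 1, and [1 - a ^+ t] takes the value 1 at
    the root 1 of ['X^n - 1]. *)
Lemma preperiod_delta : (0 < preperiod A (delta_mx (Ordinal n_gt0) 0%R))%N.
Proof.
rewrite preperiod_gt0; apply/negP=> /recursE[[//|t] _].
rewrite col_poly_delta mul1r mulr1 => /(dvdp_trans (XsubC1_dvd F n)).
have dv : 'X - 1%:P %| a ^+ t.+1 by rewrite exprS dvdp_mulr.
by rewrite (dvdp_subl _ dv) dvdp_XsubCl /root hornerE oner_eq0.
Qed.

(** The return time of [x] gives a relation modulo [Phi], from which
    [col_poly x] cancels; one more factor [a] supplies the factor ['X - 1], and
    the resulting relation modulo ['X^n - 1] holds for every [y]. *)
Lemma period_max x y :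
  coprimep (col_poly x) Phi -> (period A y <= period A x)%N.
Proof.
rewrite coprimep_sym => co_x; have [t_gt0 /eqP eq_t _] := periodP A x.
apply: (period_le t_gt0 (m := (preperiod A x).+1)); apply/eqP.
rewrite (iter_linear_eq n_gt0) // -/a dvdp_mulr //.
rewrite (iter_linear_eq n_gt0) // -/a in eq_t.
rewrite Xn_sub1_factor exprS -mulrA dvdp_mul //.
by rewrite -(Gauss_dvdpl _ co_x); apply: dvdp_trans eq_t; apply: Phi_dvd.
Qed.

(** If [x] is periodic, then [Phi] divides [1 - a ^+ t], so [a] is invertible
    modulo [Phi].  Conversely an [a] coprime to [Phi] cancels from the relation
    at the preperiod modulo [Phi], while modulo ['X - 1] the polynomial of [x]
    is 0. *)
Lemma recurs0_coprime x :
  'X - 1%:P %| col_poly x -> coprimep (col_poly x) Phi ->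
  recurs A x 0 = coprimep a Phi.
Proof.
rewrite coprimep_sym => X1_x co_x; apply/idP/idP.
  move=> /recursE[[//|t] _]; rewrite mul1r => /(dvdp_trans (Phi_dvd F n)).
  rewrite (Gauss_dvdpl _ co_x) => dv; apply/coprimepP=> d d_a /dvdp_trans/(_ dv).
  rewrite (dvdp_subl _ (_ : d %| a ^+ t.+1)) ?dvdp1 -?size_poly_eq1 //.
  by rewrite exprS dvdp_mulr.
rewrite coprimep_sym => co_a; have /recursE[t t_gt0 dv] := recurs_preperiod A x.
apply/recursE; exists t; rewrite // mul1r mulrC Xn_sub1_factor dvdp_mul //.
rewrite -(Gauss_dvdpr _ (coprimep_expr (preperiod A x) co_a)).
by rewrite -(Gauss_dvdpl _ co_x); apply: dvdp_trans dv; apply: Phi_dvd.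
Qed.

Lemma most_complicatedE x :
  'X - 1%:P %| col_poly x -> coprimep (col_poly x) Phi ->
  most_complicated A x <-> ~~ coprimep a Phi.
Proof.
move=> X1_x co_x; rewrite -(recurs0_coprime X1_x co_x) -preperiod_gt0.
split=> [[_ /(_ (delta_mx (Ordinal n_gt0) 0))]|pre_x].
  exact: leq_trans preperiod_delta.
split=> y; first exact: period_max.
exact: leq_trans (preperiod_le1 y) pre_x.
Qed.

End Complexity.

(** * The Gauss sum of a multiplicative function *)

Section Character.
Variables (F : fieldType) (n : nat) (n_prime : prime n) (f : nat -> F).
Hypotheses (f_mul : multiplicative_mod n f) (f_nontrivial : nontrivial_mod n f).
Hypotheses (f_0 : f 0%N = 0) (f_n : f n = 0).

Notation Phi := (\sum_(i < n) 'X^i : {poly F}).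
Let chi (a : 'F_n) : F := f a.

Lemma sum_Fp (V : nmodType) (h : nat -> V) :
  \sum_(a : 'F_n) h a = \sum_(i < n) h i.
Proof.
transitivity (\sum_(0 <= i < (Zp_trunc (pdiv n)).+2) h i).
  by rewrite big_mkord.
by rewrite Fp_cast // big_mkord.
Qed.

Lemma Fp_range (a : 'F_n) : a != 0 -> (1 <= a < n)%N.
Proof.
by move=> a_neq0; rewrite lt0n a_neq0 -[X in (_ < X)%N](Fp_cast n_prime) ltn_ord.
Qed.

Lemma chi0 : chi 0 = 0. Proof. exact: f_0. Qed.

Lemma chi1 : chi 1 = 1.
Proof.
have [_ [i i_n fi_neq0]] := f_mul; have [fM _] := f_mul.
have /eqP := fM i 1%N i_n (prime_gt1 n_prime); case/andP: i_n => _ lt_i.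
rewrite muln1 modn_small // -[X in X == _]mulr1 (inj_eq (mulfI _)); last exact/eqP.
by rewrite eq_sym => /eqP.
Qed.

Lemma chiM : {morph chi : x y / x * y}.
Proof.
move=> x y; have [->|x_neq0] := eqVneq x 0; first by rewrite mul0r chi0 mul0r.
have [->|y_neq0] := eqVneq y 0; first by rewrite mulr0 chi0 mulr0.
by have [fM _] := f_mul; rewrite /chi /= [X in (_ %% X)%N]Fp_cast // fM ?Fp_range.
Qed.

(** Multiplying the sum by a value [f i] other than 1 permutes its terms. *)
Lemma sum_chi : \sum_a chi a = 0.
Proof.
have [i /andP[i_gt0 lt_i] fi_neq1] := f_nontrivial.
have chi_i : chi i%:R = f i by rewrite /chi val_Fp_nat // modn_small.
have i_neq0 : i%:R != 0 :> 'F_n.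
  by rewrite -val_eqE /= val_Fp_nat // modn_small // -lt0n.
have /eqP : chi i%:R * \sum_a chi a = \sum_a chi a.
  rewrite mulr_sumr [RHS](reindex_inj (mulfI i_neq0)) /=.
  by under eq_bigr do rewrite -chiM.
rewrite -[X in _ == X]mul1r -subr_eq0 -mulrBl mulf_eq0 chi_i subr_eq0.
by move=> /orP[/eqP|/eqP].
Qed.

Lemma chiN1_neq0 : chi (-1) != 0.
Proof.
apply/eqP=> chiN1; have := chiM (-1) (-1).
by rewrite mulrNN mulr1 chi1 chiN1 mulr0 => /eqP; rewrite oner_eq0.
Qed.

Definition gauss_poly := \sum_(a : 'F_n) (chi a)%:P * 'X^a.

(** The factor ['X] makes up for the entries of [fun_vec] starting at
    [f 1]. *)
Lemma col_poly_fun_vec : 'X * col_poly (fun_vec n f) = gauss_poly.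
Proof.
rewrite /gauss_poly (sum_Fp (fun i => (f i)%:P * 'X^i)) col_polyE mulr_sumr.
under eq_bigr do rewrite mxE -scalerAr -exprS -mul_polyC.
have := @big_ord_recl _ 0 +%R n (fun i : 'I_n.+1 => (f i)%:P * 'X^i).
rewrite /= f_0 polyC0 mul0r add0r => <-.
by rewrite big_ord_recr /= f_n mul0r addr0.
Qed.

Lemma dvdp_fun_vec : 'X - 1%:P %| col_poly (fun_vec n f).
Proof.
rewrite dvdp_XsubCl; have := congr1 (horner^~ 1) col_poly_fun_vec.
rewrite hornerM hornerX mul1r /root => ->; rewrite horner_sum.
under eq_bigr do rewrite hornerCM hornerXn expr1n mulr1.
by rewrite sum_chi.
Qed.

Lemma in_qpoly_eq0 (h p : {poly F}) :
  h \is monic -> (1 < size h)%N -> (in_qpoly h p == 0) = (h %| p).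
Proof.
move=> h_monic size_h; rewrite -val_eqE /= /mk_monic size_h h_monic.
by rewrite -Pdiv.IdomainMonic.modpE.
Qed.

Notation pi := (in_qpoly Phi).

(** Modulo [Phi] the powers of ['X] form an additive character of ['F_n] of
    sum 0, so [gauss_sum_mul] exhibits [gauss_poly] as a divisor of a nonzero
    constant. *)
Lemma coprime_fun_vec : n%:R != 0 :> F -> coprimep (col_poly (fun_vec n f)) Phi.
Proof.
move=> n_neq0; apply: (coprimep_dvdr (p := gauss_poly)).
  by rewrite -col_poly_fun_vec dvdp_mull.
have n_gt0 := prime_gt0 n_prime.
have Phi_m := Phi_monic F n_gt0; have Phi_s := size_Phi F n.
have Phi_s1 : (1 < size Phi)%N by rewrite Phi_s prime_gt1.
have pi_eq p q : Phi %| p - q -> pi p = pi q.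
  by rewrite -in_qpoly_eq0 // rmorphB subr_eq0 => /eqP.
have psiD : {morph (fun a : 'F_n => pi 'X^a) : x y / x + y >-> x * y}.
  move=> x y /=; rewrite -rmorphM -exprD [X in (_ %% X)%N]Fp_cast //; apply: pi_eq.
  by rewrite -dvdpNr opprB (dvdp_trans (Phi_dvd F n)) ?dvdp_Xn_mod.
have pi_chiM : {morph (fun a => pi (chi a)%:P) : x y / x * y}.
  by move=> x y /=; rewrite chiM polyCM rmorphM.
have pi_chi0 : pi (chi 0)%:P = 0 by rewrite chi0 rmorph0.
have sum_pi_chi : \sum_a pi (chi a)%:P = 0.
  by rewrite -rmorph_sum -rmorph_sum sum_chi !rmorph0.
have pi_X0 : pi 'X^(0%R : 'F_n) = 1 by rewrite expr0 rmorph1.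
have sum_pi_X : \sum_(a : 'F_n) pi 'X^a = 0.
  rewrite (sum_Fp (fun i => pi 'X^i)) -rmorph_sum; apply/eqP.
  by rewrite in_qpoly_eq0.
have pi_GG :
    pi (gauss_poly * \sum_a (chi a^-1)%:P * 'X^a) = pi (chi (-1) *+ n)%:P.
  have := gauss_sum_mul (chi := fun a => pi (chi a)%:P)
            (psi := fun a => pi 'X^a) pi_chiM pi_chi0 sum_pi_chi psiD pi_X0 sum_pi_X.
  rewrite card_Fp // polyCMn rmorphMn rmorphM !rmorph_sum => <-.
  by congr (_ * _); apply: eq_bigr => a _; rewrite rmorphM.
move/eqP: pi_GG; rewrite -subr_eq0 -rmorphB in_qpoly_eq0 //; set c := _ *+ n => dv.
have c_neq0 : c != 0 by rewrite /c -mulr_natr mulf_neq0 ?chiN1_neq0.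
apply/coprimepP=> d d_g /dvdp_trans/(_ dv).
rewrite dvdp_subr ?dvdp_mulr // -[c%:P]mulr1 mul_polyC dvdpZr //.
by rewrite dvdp1 size_poly_eq1.
Qed.

End Character.

Theorem mainTheorem3 (n : nat) (n_prime : prime n) (n_odd : odd n)
    (F : finFieldType) (p : nat) (charF : p \in [pchar F]) (n_neq_p : n <> p)
    (f : nat -> F) (f_mul : multiplicative_mod n f)
    (f_nontrivial : nontrivial_mod n f) (f_0 : f 0%N = 0) (f_n : f n = 0)
    (A B : {linear 'cV[F]_n -> 'cV[F]_n})
    (A_inv : translation_invariant A) (B_inv : translation_invariant B)
    (A_BDelta : A =1 B \o @fdiff F n) :
  most_complicated A (fun_vec n f) <->
  ~~ coprimep (column_poly (prime_gt0 n_prime) B) (\sum_(i < n) 'X^i).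
Proof.
have n_neq0 : n%:R != 0 :> F.
  have /andP[p_prime _] := charF.
  rewrite -(dvdn_pcharf charF) dvdn_prime2 // eq_sym; exact/eqP.
rewrite -(coprime_column_poly (prime_gt0 n_prime) B_inv A_BDelta n_neq0).
apply: most_complicatedE => //.
- exact: dvdp_column_poly B_inv A_BDelta.
- exact: dvdp_fun_vec.
- exact: coprime_fun_vec.
Qed.
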